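(* Let $n$ and $k$ be integers with $k \ge 1$ and $n > 2k$. For every $i = 0, 1, \dots, k-1$, the chromatic number of $G_i(n,k)$ coincides with that of the Kneser graph $K(n,k)$, namely $$\chi(G_i(n,k)) = \chi(K(n,k)) = n - 2k + 2.$$
   Context: A graph is a pair $G = (V(G), E(G))$ of a set $V(G)$ together with a symmetric binary relation $E(G)$ on $V(G)$ (loops allowed); $v \sim_G w$ means $(v,w) \in E(G)$. A graph homomorphism is an adjacency-preserving map of vertex sets; an automorphism is a graph homomorphism from a graph to itself having an inverse that is a graph homomorphism. An $m$-coloring of $G$ is a graph homomorphism from $G$ to the complete graph $K_m$, and $\chi(G)$ is the smallest $m$ for which an $m$-coloring exists. The categorical product $G \times H$ has vertex set $V(G) \times V(H)$, with $(v,w) \sim (v',w')$ if and only if $v \sim_G v'$ and $w \sim_H w'$. $K_2$ is the complete graph on the vertices $1,2$, and $\tau$ is its non-trivial automorphism $1 \leftrightarrow 2$. $S_n$ is the symmetric group of $[n] = \{1, \dots, n\}$. For positive integers $n > 2k$, the Kneser graph $K(n,k)$ has as vertices the $k$-element subsets of $[n]$, two of them being adjacent if and only if they are disjoint; $S_n$ acts on it by $s \mapsto \sigma(s)$. The bipartite Kneser graph is $H(n,k) = K_2 \times K(n,k)$. A bigraph is a graph $X$ equipped with a graph homomorphism $\varepsilon \colon X \to K_2$; an automorphism $\alpha$ of $X$ with $\alpha^2 = \mathrm{id}$ and $\varepsilon(\alpha(x)) \neq \varepsilon(x)$ for all $x \in V(X)$ is called an odd involution. For such $X$ and $\alpha$,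 the quotient graph $X/\alpha$ has vertex set $\{\{x, \alpha(x)\} : x \in V(X)\}$, and two vertices $p, q$ of $X/\alpha$ are adjacent if and only if there are $x \in p$ and $y \in q$ with $x \sim_X y$. The graph $H(n,k)$ is a bigraph via the projection $(j,s) \mapsto j$ to $K_2$. For $0 \le i \le \lfloor n/2 \rfloor$ let $\sigma_i = (1,2)(3,4)\cdots(2i-1,2i) \in S_n$ (with $\sigma_0 = \mathrm{id}$), and let $\tau \times \sigma_i$ be the odd involution $(j,s) \mapsto (\tau(j), \sigma_i(s))$ of $H(n,k)$. Define $G_i(n,k) = H(n,k)/(\tau \times \sigma_i)$. *)

(* Defs.v *)
From mathcomp Require Import all_boot all_fingroup.

Set Implicit Arguments.
Unset Strict Implicit.
Unset Printing Implicit Defensive.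

Import GroupScope.

(* Finite graphs, loops allowed. *)
Record graph := Graph {
  vertex :> finType;
  adj : rel vertex;
  adj_sym : symmetric adj }.

Definition is_hom (G H : graph) (f : G -> H) : Prop :=
  forall x y : G, adj x y -> adj (f x) (f y).

Definition is_automorphism (G : graph) (f : G -> G) : Prop :=
  is_hom f /\ exists g : G -> G, [/\ is_hom g, cancel f g & cancel g f].

Lemma complete_adj_sym (m : nat) : symmetric (fun i j : 'I_m => i != j).
Proof. by move=> i j; rewrite eq_sym. Qed.

Definition complete_graph (m : nat) : graph := Graph (@complete_adj_sym m).

Definition colorable (G : graph) (m : nat) : Prop :=
  exists f : G -> complete_graph m, is_hom f.

(* A relation rather than a function, since a graph with a loop has no
   coloring at all; the number m is unique when it exists. *)
Definition is_chromatic_number (G : graph) (m : nat) : Prop :=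
  colorable G m /\ forall m' : nat, colorable G m' -> m <= m'.

Section Product.
Variables G H : graph.

Definition prod_adj (x y : G * H) : bool := adj x.1 y.1 && adj x.2 y.2.

Lemma prod_adj_sym : symmetric prod_adj.
Proof. by move=> x y; rewrite /prod_adj adj_sym (adj_sym x.2). Qed.

Definition prod_graph : graph := Graph prod_adj_sym.

End Product.

Record bigraph := Bigraph {
  bigraph_graph :> graph;
  parity : bigraph_graph -> complete_graph 2;
  parity_hom : is_hom parity }.

Record odd_involution (X : bigraph) := OddInvolution {
  oinv :> X -> X;
  oinv_automorphism : is_automorphism oinv;
  oinvK : involutive oinv;
  oinv_odd : forall x : X, parity (oinv x) != parity x }.

Section Quotient.
Variables (X : bigraph) (a : odd_involution X).

Definition quotient_vertex : finType :=
  {p : {set X} | p \in [set [set x; a x] | x : X]}.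

Definition quotient_adj (p q : quotient_vertex) : bool :=
  [exists x in val p, exists y in val q, adj x y].

Lemma quotient_adj_sym : symmetric quotient_adj.
Proof.
move=> p q; apply/exists_inP/exists_inP => -[x px /exists_inP[y qy xy]];
  by exists y => //; apply/exists_inP; exists x => //; rewrite adj_sym.
Qed.

Definition quotient_graph : graph := Graph quotient_adj_sym.

End Quotient.

Section Kneser.
Variables n k : nat.

(* The ground set [n] = {1, ..., n} is represented by 'I_n = {0, ..., n-1}. *)
Definition kneser_vertex : finType := {s : {set 'I_n} | #|s| == k}.

Definition kneser_adj (s t : kneser_vertex) : bool := [disjoint val s & val t].

Lemma kneser_adj_sym : symmetric kneser_adj.
Proof. by move=> s t; rewrite /kneser_adj disjoint_sym. Qed.

Definition kneser : graph := Graph kneser_adj_sym.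

Lemma kneser_act_subproof (s : 'S_n) (A : kneser) : #|s @: val A| == k.
Proof. by rewrite card_imset; [exact: (valP A) | exact: perm_inj]. Qed.

Definition kneser_act (s : 'S_n) (A : kneser) : kneser :=
  Sub (s @: val A) (kneser_act_subproof s A).

Definition bip_kneser : graph := prod_graph (complete_graph 2) kneser.

Lemma bip_kneser_fst_hom :
  @is_hom bip_kneser (complete_graph 2) (fun x => x.1).
Proof. by move=> x y /andP[]. Qed.

Definition bip_kneser_bigraph : bigraph := Bigraph bip_kneser_fst_hom.

End Kneser.

Definition tau : 'S_2 := tperm ord0 ord_max.

Section Sigma.
Variable n : nat.

Lemma pair_snd_subproof (j : 'I_n./2) : j.*2.+1 < n.
Proof. by rewrite -gtn_half_double. Qed.

Definition pair_snd (j : 'I_n./2) : 'I_n := Ordinal (pair_snd_subproof j).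
Definition pair_fst (j : 'I_n./2) : 'I_n := Ordinal (ltnW (pair_snd_subproof j)).

(* With ground set {0, ..., n-1}, the j-th transposition (j >= 0) is
   (2j, 2j+1), and sigma i is the product of those with j < i.  This is
   meant for i <= n./2; for larger i it is sigma n./2. *)
Definition pair_swap (j : 'I_n./2) : 'S_n := tperm (pair_fst j) (pair_snd j).
Definition sigma (i : nat) : 'S_n := \prod_(j < n./2 | j < i) pair_swap j.

Lemma pair_swap_comm (j l : 'I_n./2) : commute (pair_swap j) (pair_swap l).
Proof.
have [-> // | jl] := eqVneq j l.
apply/commgP/conjg_fixP; rewrite tpermJ.
have jlN : (j != l :> nat) by [].
by rewrite !tpermD //; apply: contra jlN => /eqP/(congr1 val)/= e; apply/eqP;
   move/(congr1 half): e; rewrite /= ?uphalf_double ?doubleK.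
Qed.

Lemma sigma_sq (i : nat) : sigma i * sigma i = 1.
Proof.
rewrite /sigma.
set s := \prod_(_ < _ | _) _.
suff [] : s * s = 1 /\ forall l, commute (pair_swap l) s by [].
rewrite {}/s; elim/big_rec: _ => [|j s _ [ss cs]].
  by split=> [|l]; [rewrite mulg1 | exact: commute1].
split=> [|l]; last by apply: commuteM; [exact: pair_swap_comm | exact: cs].
by rewrite {2}(cs j) mulgA -(mulgA _ s s) ss mulg1 tperm2.
Qed.

End Sigma.

Section QuotientKneser.
Variables n k i : nat.

Definition tau_sigma (x : bip_kneser_bigraph n k) : bip_kneser_bigraph n k :=
  (tau x.1, kneser_act (sigma n i) x.2).

Lemma tau_sigmaK : involutive tau_sigma.
Proof.
move=> [j s]; congr pair; first exact: tpermK.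
apply: val_inj => /=; rewrite -imset_comp -[RHS]imset_id.
by apply: eq_imset => x /=; rewrite -permM sigma_sq perm1.
Qed.

Lemma tau_sigma_automorphism : is_automorphism tau_sigma.
Proof.
have h : is_hom tau_sigma.
  move=> [j s] [j' s'] /andP[/= jj' ss']; apply/andP; split => /=.
    by rewrite (inj_eq perm_inj).
  by rewrite /kneser_adj /= imset_disjoint //; exact: perm_inj.
by split=> //; exists tau_sigma; split=> //; exact: tau_sigmaK.
Qed.

Lemma tau_sigma_odd (x : bip_kneser_bigraph n k) :
  parity (tau_sigma x) != parity x.
Proof.
case: x => [j s] /=; rewrite /tau; case: tpermP => [->|->|] //.
by case: j => [[|[|]]] // p /eqP + /eqP; rewrite -!val_eqE.
Qed.

Definition tau_sigma_involution : odd_involution (bip_kneser_bigraph n k) :=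
  OddInvolution tau_sigma_automorphism tau_sigmaK tau_sigma_odd.

Definition quotient_kneser : graph := quotient_graph tau_sigma_involution.

End QuotientKneser.

(* Main.v *)
Require Import Defs.
From mathcomp Require Import all_boot.
From mathcomp Require Import all_fingroup zify.

Set Implicit Arguments.
Unset Strict Implicit.
Unset Printing Implicit Defensive.

(** Write the vertices of [G_i(n, k)] as k-sets: the class of [(0, s)] is
    adjacent to the class of [(0, t)] iff [s] is disjoint from [sigma_i t].

    Upper bound.  Color [s] by the largest excess [x - (2k - 2)] (truncated) of
    an element [x] of [s].  Two disjoint k-sets differ in color: a common
    positive color is attained at a common element, and color 0 means lying
    inside the first [2k - 1] points, where two disjoint k-sets do not fit.
    Since [i < k], [sigma_i] moves only points among the first [2k - 2], so the
    coloring is invariant under [tau * sigma_i] and descends to the quotient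
    ([quotient_hom], [excess_disjoint], [excess_sigma]).

    Lower bound.  Let [E] hold the first element of each of the [i] pairs
    exchanged by [sigma_i], so that [E] and [sigma_i E] are disjoint.  Adding
    [E] to the (k - i)-subsets of the remaining [n - 2i] points, all fixed by
    [sigma_i], maps [K(n - 2i, k - i)] homomorphically into [G_i(n, k)]
    ([kneser_embed]).  As [(n - 2i) - 2(k - i) = n - 2k], the bound for the
    quotients follows from the one for Kneser graphs, the Lovasz-Kneser theorem
    ([kneser_lower]).

    That theorem is deduced from a combinatorial form of the Borsuk-Ulam theorem
    ([fan]).  A nonempty signed subset [x] of an n-set is a vertex of the
    barycentric subdivision of the boundary of the n-dimensional cross-polytope.
    Suppose that each [x] gets a sign, reversed by [x |-> -x], and a magnitude
    below [m], invariant under [x |-> -x], so that nested signed sets of the same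
    magnitude have the same sign; then [n <= m].  The proof counts modulo 2 the
    maximal flags of signed sets whose labels, in order of magnitude, have
    alternating signs beginning with +.  In the first [d] coordinates the number
    of such flags is odd for every [d] ([odd_flags]).  Indeed, the flags in the
    first [d + 1] coordinates on which the last of these is positive form a
    hemisphere, whose boundary is the sphere of the flags in the first [d].
    Count the facets of the hemisphere that alternate beginning with +: inner
    facets cancel in pairs, so the count is that of the boundary sphere, and each
    flag contributes 1 exactly when it alternates, beginning with either sign
    ([alternating_facets]); beginning with - on this hemisphere amounts to
    beginning with + on the opposite one.  An alternating flag of n signed sets has n distinct
    magnitudes, whence [n <= m].

    From an m-coloring of [K(n, k)] one labels a signed set [(A, B)] by its size
    when this is at most [2k - 2].  Otherwise [A] or [B] contains a k-set, and
    the label is the largest color of a k-set inside [A] or inside [B], with the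
    side on which it occurs as sign: equal colors on both sides would belong to
    disjoint k-sets.  Hence [n <= 2k - 2 + m]. *)

(** * Alternating sequences of labels *)

Lemma xor_involution (T : finType) (P F : pred T) (f : T -> T) :
    involutive f ->
    {in P, forall x, [/\ P (f x), F (f x) = F x & f x != x]} ->
  \big[addb/false]_(x | P x) F x = false.
Proof.
move=> fK fP.
(* [b] selects one element in each orbit of [f]. *)
pose b x := enum_rank x < enum_rank (f x).
have bf x : P x -> b (f x) = ~~ b x.
  move=> /fP[_ _ ne]; rewrite /b fK -leqNgt ltn_neqAle.
  by rewrite (inj_eq (@ord_inj _)) (inj_eq enum_rank_inj) (negPf ne).
rewrite (bigID b) /= [X in _ (+) X](reindex_inj (inv_inj fK)) /=.
rewrite [X in _ (+) X](eq_big (fun x => P x && b x) F) ?addbb //.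
  move=> x; apply/andP/andP => -[Px bx].
    have Pffx : P x by have [+ _ _] := fP _ Px; rewrite fK.
    by split=> //; move: bx; rewrite bf // negbK.
  by have [Pfx _ _] := fP _ Px; rewrite bf // negbK.
move=> x /andP[Pfx _]; have [+ _ _] := fP _ Pfx; rewrite fK => Px.
by have [_ -> _] := fP _ Px.
Qed.

Fixpoint alternates (b : bool) (u : seq bool) : bool :=
  if u is c :: v then (c == b) && alternates (~~ b) v else true.

(** A signed label of magnitude [a] and sign [e] is coded by the number
    [2 a + e]: the order on codes sorts labels by magnitude, [half] recovers the
    magnitude and [odd] the sign. *)
Definition alternating (b : bool) (s : seq nat) : bool :=
  alternates b (map odd (sort leq s)).

Lemma alternating_perm b s t : perm_eq s t -> alternating b s = alternating b t.
Proof.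
move=> st; rewrite /alternating; congr (alternates _ (map _ _)).
by apply/(perm_sortP leq_total leq_trans anti_leq).
Qed.

(** Deleting the head or another occurrence of the same value gives the same
    sequence, because equal values are consecutive in a sorted sequence. *)
Lemma rem_cons_sorted x y (t : seq nat) :
  sorted leq (y :: t) -> x \in t -> rem x (y :: t) = y :: rem x t.
Proof.
rewrite /=; case: (eqVneq y x) => [-> | //].
case: t => // z t /= /andP[xz zt]; case: (eqVneq z x) => [-> // | zx].
rewrite inE eq_sym (negPf zx) /= => xt.
have /allP/(_ x xt) zx' := order_path_min leq_trans zt.
by case/eqP: zx; apply/eqP; rewrite eqn_leq zx' xz.
Qed.

(** A deletion that leaves a sequence alternating from [b] removes the last entry
    of a sequence alternating from [b], the first entry of one alternating from
    [~~ b], or either of two neighbours of equal parity in a sequence that fails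
    to alternate only there; the last case contributes an even number. *)
Lemma alternates_facets b (t : seq nat) : sorted leq t ->
  \big[addb/false]_(x <- t) alternates b (map odd (rem x t)) =
  alternates b (map odd t) (+) alternates (~~ b) (map odd t).
Proof.
elim: t b => [|y t IH] b st; first by rewrite big_nil.
rewrite big_cons {1}/rem eqxx.
rewrite (eq_big_seq
  (fun x => (odd y == b) && alternates (~~ b) (map odd (rem x t)))); last first.
  by move=> x xt; rewrite rem_cons_sorted.
rewrite /= -(big_distrr _ _ _) /= IH ?(path_sorted st) // negbK.
case: (odd y) b => -[] /=; rewrite ?addbF ?addFb ?addbA ?addbb //.
  by rewrite addbC addbA addbb.
by rewrite addbC addbA addbb.
Qed.

Definition del (T : Type) l (s : seq T) := take l s ++ drop l.+1 s.

Lemma alternating_facets b (s : seq nat) :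
  \big[addb/false]_(l < size s) alternating b (del l s) =
  alternating b s (+) alternating (~~ b) s.
Proof.
pose t := sort leq s; have st : perm_eq s t by rewrite perm_sym perm_sort.
have tS : sorted leq t by apply: sort_sorted leq_total _.
transitivity (\big[addb/false]_(x <- s) alternating b (rem x s)).
  rewrite (big_nth 0) big_mkord; apply: eq_bigr => l _.
  apply: alternating_perm; rewrite -(perm_cons (nth 0 s l)).
  rewrite (perm_trans _ (perm_to_rem (mem_nth 0 (ltn_ord l)))) //.
  rewrite -[X in perm_eq _ X](cat_take_drop l) (drop_nth 0) //.
  by rewrite /del -cat1s perm_catCA.
rewrite (perm_big t) //= -alternates_facets //.
apply: eq_big_seq => x xt; rewrite (alternating_perm b (t := rem x t)).
  rewrite /alternating sorted_sort //; first exact: leq_trans.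
  exact: subseq_sorted leq_trans _ _ (rem_subseq _ _) tS.
rewrite -(perm_cons x) -(permPl (perm_to_rem _)) -?(permPr (perm_to_rem xt)) //.
by rewrite (perm_mem st).
Qed.

(** The change of sign on codes: it exchanges [2 a] and [2 a + 1]. *)
Definition neg (a : nat) : nat := ~~ odd a + a./2.*2.

Lemma alternates_negb b u : alternates b (map negb u) = alternates (~~ b) u.
Proof. by elim: u b => //= c u IH b; rewrite IH; case: c b => -[]. Qed.

(** When a magnitude determines its label, changing all signs preserves the order
    of the codes; otherwise [2 a] and [2 a + 1] would be exchanged. *)
Lemma alternating_neg b s : {in s &, injective half} ->
  alternating b (map neg s) = alternating (~~ b) s.
Proof.
move=> s_inj; have sS : all [in s] (sort leq s) by rewrite all_sort; apply/allP.
have -> : alternating b (map neg s) =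
    alternates b (map odd (map neg (sort leq s))).
  rewrite (alternating_perm b (t := map neg (sort leq s))); last first.
    by rewrite perm_map // perm_sym perm_sort.
  rewrite /alternating sorted_sort //; first exact: leq_trans.
  apply: (homo_sorted_in (P := [in s]) (e := leq)) => //.
    move=> x y xs ys xy; have := s_inj x y xs ys; rewrite /neg.
    by case: (eqVneq x./2 y./2) => [e /(_ e) -> // | + _]; lia.
  exact: sort_sorted leq_total _.
rewrite /alternating -alternates_negb -!map_comp.
congr alternates; apply: eq_map => a /=.
by rewrite /neg oddD odd_double addbF oddb.
Qed.

(** Consecutive sorted codes differ in sign, hence are distinct, and so are
    their magnitudes. *)
Lemma alternating_size b m s : {in s &, injective half} ->
  {in s, forall a, a./2 < m} -> alternating b s -> size s <= m.
Proof.
move=> s_inj s_lt; rewrite /alternating => alt.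
have : uniq (sort leq s).
  have := sort_sorted leq_total s.
  suff lt t b' : alternates b' (map odd t) -> sorted leq t -> sorted ltn t.
    by move=> /(lt _ _ alt); apply: (sorted_uniq ltn_trans ltnn).
  elim: t b' => [|x [|y t] IH] //= b' /and3P[xb yb alt'] /andP[xy yt].
  apply/andP; split; last by apply: (IH (~~ b')); rewrite ?yt //= yb.
  rewrite ltn_neqAle xy andbT; apply: contraTneq yb => <-.
  by rewrite (eqP xb); case: (b').
rewrite sort_uniq => s_uniq; rewrite -(size_map half) -(size_iota 0 m).
apply: uniq_leq_size; first by rewrite map_inj_in_uniq.
by move=> _ /mapP[a /s_lt am ->]; rewrite mem_iota.
Qed.

(** * Flags of signed sets *)

Fixpoint swap (T : Type) l (w : seq T) : seq T :=
  if w is x :: v then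
    if l is l'.+1 then x :: swap l' v
    else if v is y :: u then y :: x :: u else w
  else w.

Lemma swapK (T : Type) l : involutive (@swap T l).
Proof. by elim: l => [[|x [|y w]] | l IH [|x w]] //=; rewrite IH. Qed.

Lemma perm_swap (T : eqType) l (w : seq T) : perm_eq (swap l w) w.
Proof.
elim: l w => [[|x [|y w]] | l IH [|x w]] //=; last by rewrite perm_cons.
exact/permPl/(perm_catCA [:: y] [:: x] w).
Qed.

Lemma swap_neq (T : eqType) l (w : seq T) :
  uniq w -> l.+1 < size w -> swap l w != w.
Proof.
elim: l w => [[|x [|y w]] | l IH [|x w]] //=.
  by rewrite inE eqseq_cons negb_or eq_sym -andbA => /and3P[/negPf-> _ _].
by move=> /andP[_ uw] lw; rewrite eqseq_cons eqxx /= IH.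
Qed.

Section Fan.

Variables (n m : nat).
Variables (mag : {set 'I_n * bool} -> nat) (sgn : {set 'I_n * bool} -> bool).

(** A set of signed coordinates is a signed subset of ['I_n] when no coordinate
    occurs in it with both signs. *)
Definition signed (x : {set 'I_n * bool}) := {in x &, injective fst}.

Definition opp1 (p : 'I_n * bool) := (p.1, ~~ p.2).
Definition opp (x : {set 'I_n * bool}) := opp1 @: x.

Definition label (x : {set 'I_n * bool}) : nat := sgn x + (mag x).*2.

(** A flag of signed sets is encoded by the word of the signed coordinates that
    its members add one by one, the last added one first: the members are the
    sets of entries of the nonempty suffixes, and the head of [labels] is the
    label of the largest one. *)
Fixpoint labels (w : seq ('I_n * bool)) : seq nat :=
  if w is _ :: v then label [set p in w] :: labels v else [::].

(** The words that encode the maximal flags in the first [d] coordinates. *)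
Definition flag d (w : seq ('I_n * bool)) : bool :=
  perm_eq [seq val p.1 | p <- w] (iota 0 d).

Lemma size_labels w : size (labels w) = size w.
Proof. by elim: w => //= p w ->. Qed.

Lemma flag_perm d v w : perm_eq v w -> flag d v = flag d w.
Proof. by move=> vw; rewrite /flag; exact: (permPl (perm_map _ vw)). Qed.

Lemma flag_uniq d w : flag d w -> uniq (map fst w).
Proof.
move=> /perm_uniq; rewrite iota_uniq => w_uniq.
by rewrite -(map_inj_uniq val_inj) -map_comp.
Qed.

Lemma flag_cons d (i : 'I_n) b w :
  val i = d -> flag d.+1 ((i, b) :: w) = flag d w.
Proof.
move=> id; rewrite /flag -[d.+1]addn1 iotaD add0n cats1 /= id.
by rewrite perm_sym perm_rcons perm_cons perm_sym.
Qed.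

(** Exchanging two adjacent entries changes only the member of the flag that lies
    between them: two maximal flags share the facet that omits this member. *)
Lemma labels_swap l w : del l.+1 (labels (swap l w)) = del l.+1 (labels w).
Proof.
elim: l w => [[|x [|y w]] | l IH [|x w]] //=.
  rewrite /del /=; congr (label _ :: _); apply/setP => p.
  by rewrite !inE orbCA.
rewrite /del /= -!/(del _ _); congr (label _ :: _); last exact: IH.
by apply/setP => p; rewrite !inE (perm_mem (perm_swap _ _)).
Qed.

Lemma opp1K : involutive opp1.
Proof. by case=> i b; rewrite /opp1 negbK. Qed.

Hypothesis mag_opp : forall x, signed x -> x != set0 -> mag (opp x) = mag x.
Hypothesis sgn_opp : forall x, signed x -> x != set0 -> sgn (opp x) = ~~ sgn x.
Hypothesis mag_lt : forall x, signed x -> x != set0 -> mag x < m.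
Hypothesis sgn_mono : forall x y, signed y -> x != set0 -> x \subset y ->
  mag x = mag y -> sgn x = sgn y.

Lemma label_half x : (label x)./2 = mag x.
Proof. exact: half_bit_double. Qed.

Lemma signed_word w : uniq (map fst w) -> signed [set p in w].
Proof.
move=> w_uniq p q; rewrite !inE; elim: w w_uniq => //= r w IH /andP[rw uw].
rewrite !inE => /predU1P[-> | pw] /predU1P[-> | qw] //; last exact: IH.
  by move=> rq; rewrite rq map_f in rw.
by move=> rp; rewrite -rp map_f in rw.
Qed.

Lemma mem_labels w a : a \in labels w -> exists l,
  [/\ a = label [set p in drop l w] & [set p in drop l w] != set0].
Proof.
elim: w => //= r w IH; rewrite inE => /predU1P[-> | /IH[l alP]].
  by exists 0; split=> //; apply/set0Pn; exists r; rewrite !inE eqxx.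
by exists l.+1.
Qed.

(** The members of a flag are nested, so [sgn_mono] applies to any two. *)
Lemma labels_inj w : uniq (map fst w) -> {in labels w &, injective half}.
Proof.
move=> w_uniq _ _ /mem_labels[k [-> k0]] /mem_labels[l [-> l0]].
rewrite !label_half /label => e; rewrite e; congr (_ + _); congr nat_of_bool.
have drop_signed j : signed [set p in drop j w].
  by apply: signed_word; rewrite map_drop drop_uniq.
have drop_sub i j : i <= j -> [set p in drop j w] \subset [set p in drop i w].
  move=> ij; apply/subsetP => p; rewrite !inE -(subnK ij) -drop_drop.
  exact: mem_drop.
have [kl|/ltnW lk] := leqP k l; [symmetry|].
  by apply: sgn_mono => //; apply: drop_sub.
by apply: sgn_mono => //; apply: drop_sub.
Qed.

Lemma labels_opp w :
  uniq (map fst w) -> labels (map opp1 w) = map neg (labels w).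
Proof.
elim: w => //= r w IH /andP[rw w_uniq]; rewrite -IH //; congr (_ :: _).
have -> : [set p in opp1 r :: map opp1 w] = opp [set p in r :: w].
  apply/setP => p; rewrite inE -map_cons -[p]opp1K.
  by rewrite (mem_map (inv_inj opp1K)) (mem_imset _ _ (inv_inj opp1K)) !inE.
have s : signed [set p in r :: w] by apply: signed_word; rewrite /= rw.
have s0 : [set p in r :: w] != set0.
  by apply/set0Pn; exists r; rewrite !inE eqxx.
rewrite /label /neg mag_opp // sgn_opp // half_bit_double.
by rewrite oddD odd_double addbF oddb.
Qed.

Lemma flag_coords d v w : map fst v = map fst w -> flag d v = flag d w.
Proof. by move=> vw; rewrite /flag !(map_comp val fst) vw. Qed.

(** Induction on the dimension by a double count of the alternating facets of the
    hemisphere [up], on which the new coordinate [top] is positive. *)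
Lemma odd_flags d : d <= n ->
  \big[addb/false]_(w : d.-tuple ('I_n * bool) | flag d w)
     alternating true (labels w).
Proof.
elim: d => [_|d IH dn].
  by rewrite (big_pred1 [tuple]) // => w; rewrite tuple0 /= eqxx.
pose top := Ordinal dn.
pose up (w : seq ('I_n * bool)) := (top, true) \in w.
have opp_inv :
    involutive (fun w : d.+1.-tuple ('I_n * bool) => map_tuple opp1 w).
  by move=> w; apply: val_inj; rewrite /= mapK //; apply: opp1K.
have flag_opp (w : seq ('I_n * bool)) : flag d.+1 (map opp1 w) = flag d.+1 w.
  by apply: flag_coords; rewrite -map_comp; apply: eq_map.
have up_opp w : flag d.+1 w -> up (map opp1 w) = ~~ up w.
  move=> fw; rewrite /up -[(top, true)]opp1K /= (mem_map (inv_inj opp1K)) /opp1 /=.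
  have : d \in [seq val p.1 | p <- w] by rewrite (perm_mem fw) mem_iota /= add0n.
  case/mapP=> -[i b] ibw /= di; have {di} ? : i = top by apply: val_inj.
  subst i; have := signed_word (flag_uniq fw).
  case: b ibw => ibw /(_ (top, true) (top, false)); rewrite !inE ibw /=.
    by move=> /(_ isT); case: (_ \in _) => // /(_ isT erefl).
  by case: (_ \in _) => // /(_ isT isT erefl).
(* Flags outside the hemisphere are opposite to flags inside it, and opposite
   labels turn a beginning with + into a beginning with -. *)
rewrite (bigID (fun w : d.+1.-tuple _ => up w)) /=.
rewrite [X in _ (+) X](reindex_inj (inv_inj opp_inv)) /=.
rewrite [X in _ (+) X](eq_big (fun w : d.+1.-tuple _ => flag d.+1 w && up w)
    (fun w : d.+1.-tuple _ => alternating false (labels w))); first last.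
- move=> w; rewrite flag_opp => /andP[/flag_uniq w_uniq _].
  by rewrite labels_opp // alternating_neg //; apply: labels_inj.
- move=> w; rewrite flag_opp; apply: andb_id2l => fw.
  by rewrite up_opp // negbK.
rewrite -big_split /=.
(* Both kinds together are counted by the alternating facets. *)
rewrite (eq_bigr (fun w : d.+1.-tuple _ =>
    \big[addb/false]_(l < d.+1) alternating true (del l (labels w)))); last first.
  move=> w _; rewrite -(alternating_facets true) size_labels size_tuple //.
(* A facet that omits a member other than the largest is shared by two flags. *)
rewrite exchange_big big_ord_recl /= [X in _ (+) X]big1 ?addbF; last first.
  move=> l _; have sP (w : d.+1.-tuple ('I_n * bool)) : size (swap l w) == d.+1.
    by rewrite (perm_size (perm_swap _ _)) size_tuple.
  apply: (xor_involution (f := fun w => Tuple (sP w))).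
    by move=> w; apply: val_inj; apply: swapK.
  move=> w /andP[fw uw]; split.
  - apply/andP; rewrite /up /= (flag_perm _ (perm_swap _ _)).
    by rewrite (perm_mem (perm_swap _ _)).
  - by rewrite /= labels_swap.
  - rewrite -val_eqE swap_neq //; first exact: map_uniq (flag_uniq fw).
    by rewrite size_tuple ltnS.
(* A facet that omits the largest member is shared by the two flags that differ
   in the sign of the last added coordinate, unless this coordinate is [top],
   whose sign is fixed: there remain the flags in the first [d] coordinates. *)
rewrite (bigID (fun w => (thead w).1 == top)) /= [X in _ (+) X](xor_involution
   (f := fun w : d.+1.-tuple _ => [tuple of opp1 (thead w) :: behead_tuple w])).
- rewrite addbF; apply: etrans (IH (ltnW dn)).
  rewrite (reindex_onto (fun w => cons_tuple (top, true) w) (@behead_tuple _ _)) /=.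
    apply: eq_big => w; last by rewrite /del /= drop0.
    rewrite eqxx andbT flag_cons // /up inE eqxx andbT /=.
    by rewrite -val_eqE /= eqxx andbT.
  move=> w; case/tupleP: w => -[i b] w.
  rewrite theadE /up /= => /andP[/andP[fw uw]] /eqP /= iT; subst i.
  apply: val_inj => /=; congr (_ :: _); congr pair.
  have := signed_word (flag_uniq fw); move: uw.
  rewrite inE => /predU1P[[] //|uw] /(_ (top, b) (top, true)).
  by rewrite !inE eqxx uw orbT => /(_ isT isT erefl) [].
- by move=> w; apply: val_inj; case/tupleP: w => p w; rewrite /= !theadE opp1K.
move=> w; case/tupleP: w => p w.
rewrite !unfold_in /= !theadE /= => /andP[/andP[fw uw] pt]; split.
- have -> : flag d.+1 (opp1 p :: w) by [].
  rewrite pt andbT /=; move: uw.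
  rewrite /up !inE => /predU1P[e|->]; last by rewrite orbT.
  by rewrite -e eqxx in pt.
- by rewrite /del /= !drop0.
- apply/eqP => /(congr1 (fun v => (thead v).2)).
  by rewrite !theadE /=; case: p.2.
Qed.

(** Fan's lemma for the barycentric subdivision of the boundary of the
    cross-polytope, hence Tucker's lemma in its octahedral form. *)
Theorem fan : n <= m.
Proof.
have [w fw alt] : exists2 w : n.-tuple ('I_n * bool),
    flag n w & alternating true (labels w).
  have := odd_flags (leqnn n); case: (pickP (fun w : n.-tuple ('I_n * bool) =>
    flag n w && alternating true (labels w))) => [w /andP[]|no]; first by exists w.
  by rewrite big1 // => w fw; have := no w; rewrite fw.
have w_uniq := flag_uniq fw.
rewrite -(size_tuple w) -size_labels.
apply: alternating_size (labels_inj w_uniq) _ alt.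
move=> _ /mem_labels[l [-> l0]]; rewrite label_half; apply: mag_lt => //.
by apply: signed_word; rewrite map_drop drop_uniq.
Qed.

End Fan.

(** * The Lovasz-Kneser theorem *)

Section KneserLower.

Variables (n k m : nat) (c : kneser n k -> complete_graph m).
Hypothesis k_gt0 : 0 < k.
Hypothesis c_hom : is_hom c.

Definition side (b : bool) (x : {set 'I_n * bool}) : {set 'I_n} :=
  [set i | (i, b) \in x].

(** Colors are shifted by one, so that 0 tells that [A] contains no k-set. *)
Definition top_color (A : {set 'I_n}) : nat :=
  \max_(s : kneser n k | val s \subset A) (c s).+1.

(** Nested signed sets of at most [2k - 2] elements with the same magnitude are
    equal, so there the sign can be any choice that [opp] reverses; the rank of
    the two sides gives one.  A larger signed set has a side with [k] elements.
    The two ranges of magnitudes are disjoint. *)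
Definition kneser_mag (x : {set 'I_n * bool}) : nat :=
  if #|x| < k.*2.-1 then #|x|.-1
  else k.*2.-2 + (maxn (top_color (side true x)) (top_color (side false x))).-1.

Definition kneser_sgn (x : {set 'I_n * bool}) : bool :=
  if #|x| < k.*2.-1 then enum_rank (side false x) < enum_rank (side true x)
  else top_color (side false x) < top_color (side true x).

Lemma top_color_le (A : {set 'I_n}) : top_color A <= m.
Proof. by apply/bigmax_leqP => s _; apply: ltn_ord. Qed.

Lemma top_color_gt0 (A : {set 'I_n}) : k <= #|A| -> 0 < top_color A.
Proof.
move=> kA; have : 0 < #|[set s : {set 'I_n} | s \subset A & #|s| == k]|.
  by rewrite cards_draws bin_gt0.
case/card_gt0P => s; rewrite inE => /andP[sA sk].
exact: (leq_trans (ltn0Sn _) (leq_bigmax_cond (F := fun s : kneser n k => (c s).+1)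
  (Sub s sk) sA)).
Qed.

Lemma top_colorP (A : {set 'I_n}) : 0 < top_color A ->
  exists2 s : kneser n k, val s \subset A & top_color A = (c s).+1.
Proof.
move=> A0; case: (pickP (fun s : kneser n k => val s \subset A)) => [s sA|no].
  rewrite /top_color (bigop.bigmax_eq_arg s) //.
  by case: arg_maxnP => // t tA _; exists t.
by move: A0; rewrite /top_color big_pred0.
Qed.

Lemma top_color_disjoint (A B : {set 'I_n}) : [disjoint A & B] -> 0 < top_color A ->
  top_color A != top_color B.
Proof.
move=> AB A0; apply/eqP => e; have [s sA cs] := top_colorP A0.
have [t tB ct] :
    exists2 t : kneser n k, val t \subset B & top_color B = (c t).+1.
  by apply: top_colorP; rewrite -e.
have : adj (c s) (c t).
  by apply: c_hom; apply: disjointWl sA _; apply: disjointWr tB _.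
by rewrite /= -val_eqE /= -eqSS -cs -ct e eqxx.
Qed.

Lemma side_disjoint x b : signed x -> [disjoint side b x & side (~~ b) x].
Proof.
move=> x_signed; apply/pred0P => i /=; rewrite !inE.
apply/negP => /andP[ib inb]; have [] := x_signed _ _ ib inb erefl.
by case: b {ib inb}.
Qed.

Lemma card_side (x : {set 'I_n * bool}) :
  #|x| = #|side true x| + #|side false x|.
Proof.
have sideE b : #|side b x| = #|[set p in x | p.2 == b]|.
  rewrite -(card_imset (mem (side b x)) (f := fun i => (i, b))) => [|i j []] //.
  apply: eq_card => p; rewrite inE; apply/imsetP/andP => [[i + ->]|[px pb]].
    by rewrite inE.
  by exists p.1; rewrite ?inE -(eqP pb) -surjective_pairing.
rewrite !sideE -[in LHS](cardsID [set p | p.2 == true]).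
congr (_ + _); apply: eq_card => p.
  by rewrite !inE.
by rewrite !inE andbC; case: p.2.
Qed.

Lemma side_opp b x : side b (opp x) = side (~~ b) x.
Proof.
apply/setP => i; rewrite !inE -[(i, b)](@opp1K n) mem_imset //.
exact: inv_inj (@opp1K n).
Qed.

Lemma card_opp (x : {set 'I_n * bool}) : #|opp x| = #|x|.
Proof. by rewrite card_imset //; apply: inv_inj (@opp1K n). Qed.

Lemma big_top (x : {set 'I_n * bool}) : k.*2.-1 <= #|x| ->
  0 < maxn (top_color (side true x)) (top_color (side false x)).
Proof.
rewrite leq_max => big.
have [/top_color_gt0-> //|tk] := leqP k #|side true x|.
by rewrite [X in _ || X]top_color_gt0 ?orbT //; have := card_side x; lia.
Qed.

Theorem kneser_lower : 2 * k <= n -> n - 2 * k + 2 <= m.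
Proof.
move=> k_le; suff : n <= k.*2.-2 + m by lia.
apply: (@fan _ _ kneser_mag kneser_sgn).
- by move=> x _ _; rewrite /kneser_mag card_opp !side_opp maxnC.
- move=> x xS x0; have dis := side_disjoint true xS.
  rewrite /kneser_sgn card_opp !side_opp /=; case: ifP => [_|/negbT].
    rewrite -leqNgt ltn_neqAle (inj_eq (@ord_inj _)) (inj_eq enum_rank_inj).
    case: eqP => // e; exfalso; case/set0Pn: x0 => -[i b] ib.
    have := disjointFr dis (x := i); move/setP: e => /(_ i); rewrite !inE.
    by case: b ib => ->; case: (_ \in x) => // _ /(_ isT).
  rewrite -!leqNgt => /big_top; rewrite leq_max => tc; rewrite ltn_neqAle.
  suff -> : top_color (side true x) != top_color (side false x) by [].
  by case/orP: tc => [/(top_color_disjoint dis) //|]; rewrite eq_sym;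
    apply: top_color_disjoint; rewrite disjoint_sym.
- move=> x xS x0; rewrite /kneser_mag; case: ifP => [|/negbT].
    by move: x0; rewrite -card_gt0; lia.
  rewrite -leqNgt => /big_top; have := top_color_le (side true x).
  by have := top_color_le (side false x); lia.
move=> x y yS x0 xy; have := subset_leq_card xy; have := card_gt0 x; rewrite x0.
rewrite /kneser_mag /kneser_sgn => x_gt0 le_xy.
case: ifP => x_small; case: ifP => y_small.
- move=> e; have -> // : x = y by apply/eqP; rewrite eqEcard xy; lia.
- by lia.
- by lia.
have x_top : 0 < maxn (top_color (side true x)) (top_color (side false x)).
  by apply: big_top; rewrite leqNgt x_small.
have y_top : 0 < maxn (top_color (side true y)) (top_color (side false y)).
  by apply: big_top; rewrite leqNgt y_small.
(* A change of sign between [x] and [y] would give a color on opposite sides. *)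
have ne b : 0 < top_color (side b x) ->
    top_color (side b x) != top_color (side (~~ b) y).
  apply: top_color_disjoint; apply: disjointWl (side_disjoint b yS).
  by apply/subsetP => i; rewrite !inE; apply: (subsetP xy).
by have := ne true; have := ne false; rewrite /=; lia.
Qed.

End KneserLower.

(** * Homomorphisms from and to the quotients *)

Lemma quotient_hom (X : bigraph) (a : odd_involution X) (H : graph) (f : X -> H) :
    is_hom f -> (forall x, f (a x) = f x) ->
  exists g : quotient_graph a -> H, is_hom g.
Proof.
move=> f_hom fa.
have repP (p : quotient_graph a) : exists x : X, [set x; a x] == val p.
  by have /imsetP[x _ px] := valP p; exists x; rewrite px.
pose g (p : quotient_graph a) := f (xchoose (repP p)).
have gE (p : quotient_graph a) x : x \in val p -> g p = f x.
  rewrite -(eqP (xchooseP (repP p))) !inE /g.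
  by case/orP=> /eqP->; rewrite ?fa.
exists g => p q /exists_inP[x xp /exists_inP[y yq xy]].
by rewrite (gE p x) // (gE q y) //; apply: f_hom.
Qed.

(** It suffices to give the representatives [(ord0, h s)]: the other element of
    the class of [(ord0, h t)] is [(tau ord0, sigma_i (h t))]. *)
Lemma kneser_quotient_hom (H : graph) n k i (h : H -> kneser n k) :
    (forall s t : H, adj s t ->
       [disjoint val (h s) & sigma n i @: val (h t)]) ->
  exists g : H -> quotient_kneser n k i, is_hom g.
Proof.
move=> h_adj; pose a := tau_sigma_involution n k i.
have cls (x : bip_kneser_bigraph n k) :
    [set x; a x] \in [set [set y; a y] | y : bip_kneser_bigraph n k].
  by apply/imsetP; exists x.
pose z s : bip_kneser_bigraph n k := (ord0, h s).
exists (fun s => Sub [set z s; a (z s)] (cls (z s))) => s t st.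
apply/exists_inP; exists (z s); first by rewrite !inE eqxx.
apply/exists_inP; exists (a (z t)); first by rewrite !inE eqxx orbT.
apply/andP; split; last exact: h_adj.
by rewrite /= /tau tpermL.
Qed.

Lemma sigma_fix n i (x : 'I_n) : i.*2 <= x -> sigma n i x = x.
Proof.
move=> ix; rewrite /sigma; elim/big_rec: _ => [|j s ji sx]; first exact: perm1.
rewrite permM [pair_swap j x]tpermD //; rewrite -val_eqE /=; lia.
Qed.

Lemma sigma_pair_fst n i (j : 'I_n./2) :
  j < i -> sigma n i (pair_fst j) = pair_snd j.
Proof.
have swap_neq (l : 'I_n./2) (x : 'I_n) : x./2 != l -> pair_swap l x = x.
  by move=> xl; rewrite /pair_swap tpermD // -val_eqE /=; lia.
have half_fst : (pair_fst j)./2 = j by rewrite /= doubleK.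
have half_snd : (pair_snd j)./2 = j by rewrite /= uphalf_double.
move=> ji; rewrite /sigma.
move: (index_enum_uniq 'I_n./2) (mem_index_enum j).
have fix_snd r : j \notin r ->
    (\prod_(l <- r | l < i) pair_swap l)%g (pair_snd j) = pair_snd j.
  elim: r => [|l r IH]; first by rewrite big_nil perm1.
  rewrite inE big_cons negb_or => /andP[jl jr]; case: ifP => _; last exact: IH.
  by rewrite permM swap_neq ?half_snd // IH.
elim: (index_enum _) => [|l r IH] //=; rewrite inE big_cons => /andP[lr r_uniq].
case: (eqVneq j l) lr => [<- lr _ | jl _ /= jr]; last first.
  by case: ifP => _; rewrite ?permM ?swap_neq ?half_fst //; apply: IH.
by rewrite ji permM tpermL fix_snd.
Qed.

(** * The bounds *)

Section Upper.

Variables n k : nat.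
Hypothesis n_gt : 2 * k < n.

Definition excess (s : {set 'I_n}) : nat := \max_(x in s) (x - k.*2.-2).

Lemma excess_lt s : excess s < n - 2 * k + 2.
Proof.
by rewrite addn2 ltnS; apply/bigmax_leqP => x _; have := ltn_ord x; lia.
Qed.

Lemma excess_disjoint (s t : {set 'I_n}) : 0 < k -> #|s| = k -> #|t| = k ->
  [disjoint s & t] -> excess s != excess t.
Proof.
move=> k0 sk tk st; apply/eqP => e.
have s0 : 0 < #|s| by rewrite sk.
have t0 : 0 < #|t| by rewrite tk.
have [x xs ex] := eq_bigmax_cond (fun x : 'I_n => x - k.*2.-2) s0.
have [y yt ey] := eq_bigmax_cond (fun x : 'I_n => x - k.*2.-2) t0.
rewrite -/(excess s) in ex; rewrite -/(excess t) in ey.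
have [exc0|exc] := posnP (excess s); last first.
  have xy : x = y by apply: val_inj => /=; lia.
  by have := disjointFr st xs; rewrite xy yt.
have k_le : k.*2.-1 <= n by lia.
have low : s :|: t \subset [set widen_ord k_le j | j : 'I_(k.*2.-1)].
  apply/subsetP => z zst; suff zk : z < k.*2.-1.
    by apply/imsetP; exists (Ordinal zk) => //; apply: val_inj.
  have : z - k.*2.-2 <= 0.
    move: zst; rewrite inE => /orP[] z_in.
      by rewrite -exc0; apply: (leq_bigmax_cond (F := fun x : 'I_n => x - k.*2.-2)).
    by rewrite -exc0 e; apply: (leq_bigmax_cond (F := fun x : 'I_n => x - k.*2.-2)).
  by lia.
have := leq_trans (subset_leq_card low) (leq_imset_card _ _).
rewrite cardsU (disjoint_setI0 st) cards0 card_ord; lia.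
Qed.

(** As [i < k], the points moved by [sigma_i] all have excess 0. *)
Lemma excess_sigma i (s : {set 'I_n}) : i < k -> excess (sigma n i @: s) = excess s.
Proof.
move=> ik; rewrite /excess big_imset /=; last by move=> x y _ _; apply: perm_inj.
apply: eq_bigr => x _.
have [xk|xk] := leqP i.*2 x; first by rewrite sigma_fix.
have [sx|sx] := leqP i.*2 (sigma n i x); last by lia.
have := sigma_fix sx; rewrite -permM sigma_sq perm1 => e; rewrite -e in sx; lia.
Qed.

Definition excess_color (s : kneser n k) : complete_graph (n - 2 * k + 2) :=
  Ordinal (excess_lt (val s)).

Lemma excess_color_hom : 0 < k -> is_hom excess_color.
Proof.
move=> k0 s t st; rewrite /= -val_eqE /=.
by apply: excess_disjoint => //; apply/eqP; [apply: (valP s) | apply: (valP t)].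
Qed.

End Upper.

(** Adjoin to each set, moved to the points [2 i] and above, the set [E] of the
    first elements of the [i] pairs that [sigma_i] exchanges. *)
Lemma kneser_embed n k i : 2 * k < n -> i < k ->
  exists g : kneser (n - i.*2) (k - i) -> quotient_kneser n k i, is_hom g.
Proof.
move=> nk ik.
have i_le : i <= n./2 by lia.
have shift_lt (x : 'I_(n - i.*2)) : i.*2 + x < n by have := ltn_ord x; lia.
pose shift x := Ordinal (shift_lt x).
have shift_inj : injective shift.
  by move=> x y /(congr1 val) /= /addnI /val_inj.
pose E := [set pair_fst (widen_ord i_le j) | j : 'I_i].
have E_lt x : x \in E -> x < i.*2.
  by case/imsetP=> j _ -> /=; have := ltn_ord j; lia.
have sE_lt x : x \in sigma n i @: E -> x < i.*2.
  case/imsetP=> _ /imsetP[j _ ->] ->; rewrite sigma_pair_fst //=.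
  by have := ltn_ord j; lia.
have sE : [disjoint E & sigma n i @: E].
  apply/pred0P => x /=; apply/andP => -[/imsetP[j _ ->] /imsetP[_ /imsetP[l _ ->]]].
  by rewrite sigma_pair_fst //= => /(congr1 val) /=; lia.
have cardE : #|E| = i.
  rewrite card_imset ?card_ord // => j l /(congr1 val) /= /double_inj.
  exact: val_inj.
have shiftP (A : {set 'I_n}) (s : {set 'I_(n - i.*2)}) :
    (forall x, x \in A -> x < i.*2) -> [disjoint A & shift @: s].
  move=> A_lt; apply/pred0P => x /=; apply/andP => -[/A_lt xi /imsetP[y _ xy]].
  by move: xi; rewrite xy /=; lia.
have s_shift (s : {set 'I_(n - i.*2)}) : sigma n i @: (shift @: s) = shift @: s.
  rewrite -[RHS]imset_id; apply: eq_in_imset => _ /imsetP[x _ ->].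
  by apply: sigma_fix; rewrite /= leq_addr.
have card_h (s : kneser (n - i.*2) (k - i)) : #|E :|: shift @: val s| == k.
  rewrite cardsU (disjoint_setI0 (shiftP _ _ E_lt)) ?cards0 // cardE card_imset //.
  by rewrite (eqP (valP s)); lia.
pose h (s : kneser (n - i.*2) (k - i)) : kneser n k :=
  Sub (E :|: shift @: val s) (card_h s).
apply: (@kneser_quotient_hom _ _ _ _ h) => s t st.
have st' : [disjoint shift @: val s & shift @: val t].
  by rewrite imset_disjoint.
rewrite /= imsetU s_shift -setI_eq0 setIUl !setIUr !setU_eq0 !setI_eq0.
by rewrite sE st' shiftP // disjoint_sym shiftP.
Qed.

Theorem theorem3 (n k : nat) (hk : 1 <= k) (hn : 2 * k < n)
    (i : nat) (hi : i < k) :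
  is_chromatic_number (quotient_kneser n k i) (n - 2 * k + 2) /\
  is_chromatic_number (kneser n k) (n - 2 * k + 2).
Proof.
split; split.
- apply: (quotient_hom
    (f := fun x : bip_kneser_bigraph n k => excess_color hn x.2)).
    by move=> x y /andP[_]; apply: excess_color_hom.
  by move=> x; apply: val_inj; rewrite /= excess_sigma.
- move=> m [c c_hom]; have [g g_hom] := kneser_embed hn hi.
  have := kneser_lower (c := c \o g); rewrite subn_gt0 => /(_ hi).
  have -> : n - i.*2 - 2 * (k - i) = n - 2 * k by lia.
  by apply; [move=> x y /g_hom; apply: c_hom | lia].
- by exists (excess_color hn); apply: excess_color_hom.
- by move=> m [c c_hom]; apply: kneser_lower c_hom (ltnW hn).
Qed.
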